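(* Let $v=(v_1,v_2):\mathbb{R}\times\mathbb{R}^2\to\mathbb{R}^2$ be smooth and assume that $$|v_1(t,x)|<1\quad\text{for all } (t,x)\in\mathbb{R}\times\mathbb{R}^2 .$$ Then the time-optimal control problem $$\text{minimize } T \quad\text{subject to}\quad \dot x = u + v(t,x),\quad x(0)=A,\ x(T)=B,\quad |x_1|\le 1,\quad u\in U,$$ with the control set equal to the square $U=\{u\in\mathbb{R}^2: |u_1|\le 1,\ |u_2|\le 1\}$, described by $\varphi_1(u)=|u_1|-1\le 0$ and $\varphi_2(u)=|u_2|-1\le 0$, is regular with respect to the state constraint in the sense defined in the context.
   Context: Here $A,B\in\mathbb{R}^2$ are given distinct points, $x=(x_1,x_2)$ is the absolutely continuous state, $u=(u_1,u_2)$ the integrable control, and $T$ the free terminal time. Regularity: put $\Gamma(t,x,u)=u_1+v_1(t,x)$, $\varphi=(\varphi_1,\varphi_2)$, and for $u\in\mathbb{R}^2$ let $I_\varphi(u)=\{i\in\{1,2\}:\varphi_i(u)=0\}$. The problem is called regular with respect to the state constraint if for all $t\ge 0$, $x\in\mathbb{R}^2$, $u\in\mathbb{R}^2$ such that $|x_1|=1$, $\varphi(u)\le 0$ (componentwise) and $\Gamma(t,x,u)=0$, the family of vectors consisting of $\frac{\partial\Gamma}{\partial u}(t,x,u)$ and $\nabla\varphi_i(u)$, $i\in I_\varphi(u)$, is linearly independent. (For the square, $\varphi_i$ is differentiable wherever $\varphi_i(u)=0$.) *)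

(* Defs.v *)
From HB Require Import structures.
From mathcomp Require Import all_boot all_order all_algebra.
From mathcomp Require Import all_classical all_reals all_analysis.
Set Implicit Arguments.
Unset Strict Implicit.
Unset Printing Implicit Defensive.
Import Order.TTheory GRing.Theory Num.Theory.
Import numFieldNormedType.Exports.
Local Open Scope classical_set_scope.
Local Open Scope ring_scope.

(* A point of R^2 is a row vector x : 'rV[R]_2; its
   coordinates x_1 and x_2 are x 0 0 and x 0 1. *)

(* On a finite-dimensional V this is the usual class C^n: f is differentiable
   and its directional derivatives, equivalently its partial derivatives, are
   of class C^(n-1). *)
Fixpoint class_C (R : realType) (V W : normedModType R) (n : nat)
    (f : V -> W) : Prop :=
  match n with
  | 0 => continuous f
  | m.+1 => (forall p : V, differentiable f p) /\
            (forall h : V, class_C m (fun p : V => 'D_h f p))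
  end.

Definition smooth (R : realType) (V W : normedModType R) (f : V -> W) : Prop :=
  forall n : nat, class_C n f.

(* An entry is meaningful only where the corresponding partial derivative
   exists: 'D_h f u has an unspecified value elsewhere. *)
Definition gradient (R : realType) (n : nat) (f : 'rV[R]_n.+1 -> R)
    (u : 'rV[R]_n.+1) : 'rV[R]_n.+1 :=
  \row_j 'D_(delta_mx 0 j) f u.

(* s lists the endpoints of finitely many non-overlapping subintervals of
   [a, b], from left to right. *)
Definition abs_continuous (R : realType) (V : normedModType R) (a b : R)
    (f : R -> V) : Prop :=
  forall e : R, 0 < e -> exists2 d : R, 0 < d &
    forall s : seq (R * R),
      all (fun I => (a <= I.1) && (I.1 <= I.2) && (I.2 <= b)) s ->
      sorted (fun I J => I.2 <= J.1) s ->
      \sum_(I <- s) (I.2 - I.1) < d ->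
      \sum_(I <- s) `|f I.2 - f I.1| < e.

(* The data of: minimize T subject to x' = u + drift (t, x), x 0 = source,
   x T = target, |x_1| <= 1 and control_constraint i u <= 0 for i = 1, 2. *)
Record time_optimal_problem (R : realType) := TimeOptimalProblem {
  source : 'rV[R]_2;
  target : 'rV[R]_2;
  drift : R * 'rV[R]_2 -> 'rV[R]_2;
  control_constraint : 'I_2 -> 'rV[R]_2 -> R
}.

Section time_optimal_problem.
Variables (R : realType) (P : time_optimal_problem R).

Definition control_set : set 'rV[R]_2 := [set u | forall i, control_constraint P i u <= 0].

Definition feasible (T : R) (x u : R -> 'rV[R]_2) : Prop :=
  [/\ 0 <= T,
      abs_continuous 0 T x /\
        (forall i, lebesgue_measure.-integrable `[0, T]
                     (fun t => (u t 0 i)%:E)),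
      {ae lebesgue_measure, forall t : R, 0 <= t <= T ->
         is_derive t 1 x (u t + drift P (t, x t)) /\ control_set (u t)},
      x 0 = source P /\ x T = target P &
      forall t : R, 0 <= t <= T -> `|x t 0 0| <= 1].

Definition optimal (T : R) (x u : R -> 'rV[R]_2) : Prop :=
  feasible T x u /\ forall T' x' u', feasible T' x' u' -> T <= T'.

Definition Gamma (t : R) (x u : 'rV[R]_2) : R := u 0 0 + drift P (t, x) 0 0.

Definition active_set (u : 'rV[R]_2) : {set 'I_2} :=
  [set i | control_constraint P i u == 0]%SET.

(* free is linear independence of the family, listed with repetitions. *)
Definition regular_wrt_state_constraint : Prop :=
  forall (t : R) (x u : 'rV[R]_2),
    0 <= t -> `|x 0 0| = 1 -> (forall i, control_constraint P i u <= 0) -> Gamma t x u = 0 ->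
    free (gradient (Gamma t x) u ::
          [seq gradient (control_constraint P i) u | i <- enum (active_set u)]).

End time_optimal_problem.

Definition square_constraint (R : realType) (i : 'I_2) (u : 'rV[R]_2) : R :=
  `|u 0 i| - 1.

Definition square_problem (R : realType) (v : R * 'rV[R]_2 -> 'rV[R]_2)
    (A B : 'rV[R]_2) : time_optimal_problem R :=
  TimeOptimalProblem A B v (@square_constraint R).

Lemma control_set_square (R : realType) (v : R * 'rV[R]_2 -> 'rV[R]_2)
    (A B : 'rV[R]_2) :
  control_set (square_problem v A B) =
  [set u : 'rV[R]_2 | `|u 0 0| <= 1 /\ `|u 0 1| <= 1].
Proof.
apply/seteqP; split=> u /=; rewrite /control_set /= /square_constraint.
  by move=> h; split; rewrite -subr_le0; apply: h.
move=> [h0 h1] i; rewrite subr_le0.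
by case: (unliftP 0 i) => [j|] ->; rewrite ?ord1 // (_ : lift 0 0 = 1) //; apply/val_inj.
Qed.

Lemma differentiable_square_constraint (R : realType) (i : 'I_2)
    (u : 'rV[R]_2) :
  square_constraint i u = 0 -> differentiable (square_constraint i) u.
Proof.
move=> /subr0_eq ui1.
have u0 : u 0 i != 0 by rewrite -normr_gt0 ui1.
have nD : derivable (Num.norm : R -> R) (u 0 i) 1.
  apply: (@near_eq_derivable _ _ _ (fun x : R => Num.sg (u 0 i) * x)) => //.
    rewrite ?oner_eq0 //.
  have [up|un|/eqP] := ltrgt0P (u 0 i); last by rewrite (negPf u0).
    near=> x; rewrite gtr0_sg // mul1r gtr0_norm //; near: x.
    exact: lt_nbhsr.
  near=> x; rewrite ltr0_sg // mulN1r ltr0_norm //; near: x.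
  exact: lt_nbhsl.
have : differentiable (fun w : 'rV[R]_2 => `|w 0 i|) u.
  apply: (@differentiable_comp _ _ _ _ (fun w : 'rV[R]_2 => w 0 i) Num.norm).
    exact: differentiable_coord.
  exact/derivable1_diffP.
move=> h; apply: differentiableB => //.
Unshelve. all: by end_near.
Qed.

(* Main.v *)
Require Import Defs.
From mathcomp Require Import all_boot all_order all_algebra.
From mathcomp Require Import all_classical all_reals all_analysis.
Import Order.TTheory GRing.Theory Num.Theory.
Import numFieldNormedType.Exports.
Local Open Scope ring_scope.

(** If [Gamma t x u = 0] then [|u_1| = |v_1 (t, x)| < 1], so the constraint
    [|u_1| <= 1] is inactive. The family therefore consists of the gradient
    [(1, 0)] of [Gamma] and, when [|u_2| = 1], of [(0, +-1)]. *)

(** ['D] is defined as a limit of difference quotients, so equal increments give the same value,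
    whether or not the limit exists. As the two domains may differ, partial derivatives on row
    vectors reduce to derivatives in one real variable. *)
Lemma eq_derive_increment (R : realType) (V V' W : normedModType R)
    (f : V -> W) (g : V' -> W) (a v : V) (b w : V') :
  (forall h : R, f (h *: v + a) - f a = g (h *: w + b) - g b) ->
  'D_v f a = 'D_w g b.
Proof.
move=> fg; rewrite /derive.
suff -> : (fun h : R => h^-1 *: ((f \o shift a) (h *: v) - f a)) =
          (fun h : R => h^-1 *: ((g \o shift b) (h *: w) - g b)) by [].
by apply/funext => h /=; rewrite fg.
Qed.

Lemma gradient_coord (R : realType) (n : nat) (g : R -> R) (i : 'I_n.+1)
    (u : 'rV[R]_n.+1) :
  gradient (fun w => g (w 0 i)) u = 'D_1 g (u 0 i) *: delta_mx 0 i.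
Proof.
apply/rowP => j; rewrite !mxE eqxx /=.
(* Along [delta_mx 0 j] the coordinate [i] moves at speed 1 if [j = i] and stays fixed otherwise. *)
have -> : 'D_(delta_mx 0 j) (fun w : 'rV[R]_n.+1 => g (w 0 i)) u
        = 'D_((j == i)%:R) g (u 0 i).
  apply: eq_derive_increment => h.
  by rewrite !mxE eqxx /= [i == j]eq_sym.
by have [_|_] := eqVneq j i; rewrite ?derive0 ?mulr1 ?mulr0.
Qed.

(** Near [y != 0] the sign is constant, so the absolute value coincides there with the linear map
    [x => Num.sg y * x]. *)
Lemma derive_norm_sg (R : realType) (y : R) :
  y != 0 -> 'D_1 (Num.norm : R -> R) y = Num.sg y.
Proof.
move=> y0; rewrite (@near_eq_derive _ _ _ _ (fun x : R => Num.sg y * x)).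
  by rewrite deriveMl // derive_id mulr1.
have [yp|yn|/eqP] := ltrgt0P y; last by rewrite (negPf y0).
  near=> x; rewrite (gtr0_sg yp) mul1r gtr0_norm //; near: x.
  exact: lt_nbhsr.
near=> x; rewrite (ltr0_sg yn) mulN1r ltr0_norm //; near: x.
exact: lt_nbhsl.
Unshelve. all: by end_near.
Qed.

Lemma gradient_square_constraint (R : realType) (i : 'I_2) (u : 'rV[R]_2) :
  u 0 i != 0 ->
  gradient (@square_constraint R i) u = Num.sg (u 0 i) *: delta_mx 0 i.
Proof.
move=> ui; rewrite (gradient_coord _ _ (fun y => `|y| - 1)); congr (_ *: _).
rewrite -derive_norm_sg //.
(* The constant [- 1] cancels in the increments. *)
by apply: eq_derive_increment => h; rewrite opprB addrA subrK.
Qed.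

Theorem proposition1 (R : realType) (v : R * 'rV[R]_2 -> 'rV[R]_2)
    (A B : 'rV[R]_2) (hAB : A <> B) (hsmooth : smooth v)
    (hv : forall (t : R) (x : 'rV[R]_2), `|v (t, x) 0 0| < 1) :
  regular_wrt_state_constraint (square_problem v A B).
Proof.
move=> t x u _ _ _ /eqP; rewrite addr_eq0 => /eqP u0E.
set P := square_problem v A B.
have grad_Gamma : gradient (Gamma P t x) u = delta_mx 0 0.
  rewrite /Gamma (gradient_coord _ _ (fun y => y + drift P (t, x) 0 0)).
  by rewrite deriveD // derive_id derive_cst addr0 scale1r.
have inactive0 : 0 \notin active_set P u.
  by rewrite inE /= /square_constraint subr_eq0 u0E normrN lt_eqF.
have e0 : delta_mx 0 0 != 0 :> 'rV[R]_2.
  by apply/eqP => /rowP/(_ 0); rewrite !mxE eqxx => /eqP; rewrite oner_eq0.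
have ord2 (i : 'I_2) : i != 0 -> i = 1.
  by case: i => -[|[|//]] // lt2 _; apply/val_inj.
rewrite grad_Gamma.
have [active1|inactive1] := boolP (1 \in active_set P u); last first.
  have -> : active_set P u = finset.set0.
    apply/finset.setP => i; rewrite finset.in_set0; apply/negbTE.
    by have [->|/ord2 ->] := eqVneq i 0.
  by rewrite finset.enum_set0 /= seq1_free.
have -> : active_set P u = finset.set1 1.
  apply/finset.setP => i; rewrite finset.in_set1.
  have [->|/ord2 ->] := eqVneq i 0; first exact/negbTE.
  by rewrite active1 eqxx.
(* An active constraint forces [u] away from the kink of the absolute value, where the gradient
   formula would fail. *)
have u1 : u 0 1 != 0.
  move: active1; rewrite inE /= /square_constraint subr_eq0 => /eqP u1E.
  by rewrite -normr_gt0 u1E.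
rewrite finset.enum_set1 /= gradient_square_constraint //.
rewrite free_cons seq1_free span_seq1; apply/andP; split.
  (* Coordinate 0 separates the two vectors: it is 1 for the gradient of [Gamma] and 0 for every
     multiple of the other one. *)
  apply/negP => /vlineP[k] /rowP/(_ 0); rewrite !mxE !eqxx /= !mulr0.
  by move/eqP; rewrite oner_eq0.
rewrite scaler_eq0 sgr_eq0 (negPf u1) /=.
by apply/eqP => /rowP/(_ 1); rewrite !mxE !eqxx => /eqP; rewrite oner_eq0.
Qed.
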